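(* Let $K$ be a field of characteristic zero and let $n\ge1$, $d\ge0$ be integers with $d+1>\frac{n}{2}$. Then there are no nonempty nonsingular $d$-complexes on $n$ vertices that are balanceable over $K$.
   Context: A $d$-simplex on a set $\mathcal{S}$ is a multiset of cardinality $d+1$ with elements in $\mathcal{S}$; a $d$-complex on $n$ vertices is a set $\Delta$ of $d$-simplices on a set $\mathcal{S}$ with $|\mathcal{S}|=n$ (not every element of $\mathcal{S}$ need be used). A complex is nonsingular if in each of its simplices every element has multiplicity one. $m(i\in S)$ is the multiplicity of $i$ in the multiset $S$, and $m(T\subseteq S)=\prod_{i}\binom{m(i\in S)}{m(i\in T)}$ (zero if $T\not\subseteq S$). A $d$-complex $\Delta$ is balanceable over $K$ if there is a function $w:\Delta\to K$ with $w(\sigma)\ne0$ for all $\sigma\in\Delta$ such that $\sum_{S\subseteq\sigma\in\Delta}w(\sigma)\,m(S\subseteq\sigma)=0$ for every multiset $S$ on $\mathcal{S}$ with $0\le|S|\le d$. *)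

(* Defs.v *)
From mathcomp Require Import all_boot all_algebra.
From mathcomp Require Import finmap multiset.
Set Implicit Arguments.
Unset Strict Implicit.
Unset Printing Implicit Defensive.
Import GRing.Theory.
Local Open Scope fset_scope.
Local Open Scope mset_scope.
Local Open Scope ring_scope.

(* Since V is finite there are finitely many multisets of size d + 1 on V, so
   taking Delta to be a finite set loses no generality. *)
Definition is_complex (n d : nat) (V : finType) (Delta : {fset {mset V}}) :
    Prop :=
  #|V| = n /\ forall sigma : {mset V}, sigma \in Delta -> size sigma = d.+1.

Definition nonsingular (V : finType) (Delta : {fset {mset V}}) : Prop :=
  forall sigma : {mset V}, sigma \in Delta ->
  forall i : V, i \in sigma -> sigma i = 1%N.

(* m(T \subseteq S); it vanishes when T is not a sub-multiset of S, because
   'C(a, b) = 0 for a < b. *)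
Definition msub_mult (V : finType) (T S : {mset V}) : nat :=
  (\prod_(i : V) 'C(S i, T i))%N.

Definition balanceable (K : fieldType) (d : nat) (V : finType)
    (Delta : {fset {mset V}}) : Prop :=
  exists w : Delta -> K,
    (forall sigma : Delta, w sigma != 0) /\
    (forall S : {mset V}, (size S <= d)%N ->
       \sum_(sigma : Delta | (S `<=` val sigma)%mset)
          w sigma * (msub_mult S (val sigma))%:R = 0).

(* Main.v *)
Require Import Defs.
From mathcomp Require Import all_boot all_algebra.
From mathcomp Require Import finmap multiset.
Import GRing.Theory.
Local Open Scope fset_scope.
Local Open Scope mset_scope.
Local Open Scope ring_scope.

(** In a nonsingular complex every simplex is a plain set of [d.+1] vertices and
    every multiplicity [m(S \subseteq sigma)] with [S] inside [sigma] is [1],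
    so a balancing [w] has vanishing sums over all the simplices that contain a
    given set of at most [d] vertices.  By inclusion-exclusion, the sum of [w]
    over the simplices that avoid a given set [B] of at most [d] vertices is an
    alternating sum of such sums over the subsets of [B], hence vanishes too
    ([sum_disjoint_eq0]).

    Take for [B] the complement of a simplex [sigma0].  It has [n - d.+1]
    vertices, which is at most [d] exactly because [n / 2 < d.+1].  A simplex
    that avoids [B] lies inside [sigma0] and has the same size, so it is
    [sigma0] itself.  The vanishing sum is then [w sigma0], which was required
    to be nonzero. *)

(** Inclusion-exclusion.  The set [A] of vertices that are imposed makes the
    induction on the set [B] of forbidden vertices work: the members that avoid
    [B] are those that avoid [B :\ b], minus those among them that contain [b],
    and moving [b] from [B] to [A] does not increase
    [#|A| + #|B|]. *)
Lemma sum_subset_disjoint_eq0 {U : zmodType} {V I : finType}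
    (F : I -> {set V}) (w : I -> U) (d : nat) (A B : {set V}) :
  (forall C : {set V}, (#|C| <= d)%N -> \sum_(i | C \subset F i) w i = 0) ->
  (#|A| + #|B| <= d)%N ->
  \sum_(i | (A \subset F i) && [disjoint B & F i]) w i = 0.
Proof.
move=> w0; have [m ltBm] := ubnP #|B|.
elim: m => // m IHm in A B ltBm *; move=> leABd.
have [B0|[b bB]] := set_0Vmem B.
  rewrite -[RHS](w0 A) ?(leq_trans (leq_addr _ _) leABd) //.
  by apply: eq_bigl => i; rewrite B0 disjoints_subset sub0set andbT.
have ltB : (#|B :\ b| < #|B|)%N by rewrite (cardsD1 b B) bB.
have B_DU i : ([disjoint B & F i] = (b \notin F i) && [disjoint B :\ b & F i])%B.
  by rewrite -{1}(setD1K bB) !disjoints_subset subUset sub1set inE.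
have ltDm := leq_trans ltB ltBm.
have := IHm A _ ltDm (leq_trans (leq_add (leqnn _) (ltnW ltB)) leABd).
rewrite (bigID (fun i => b \in F i)) /= (eq_bigl (fun i =>
  (b |: A \subset F i) && [disjoint B :\ b & F i])); last first.
  by move=> i; rewrite subUset sub1set [LHS]andbC andbA.
rewrite IHm // ?add0r; last first.
  apply: leq_trans leABd; rewrite cardsU1 [#|B|](cardsD1 b) bB [leqRHS]addnCA addnA.
  by rewrite !leq_add2r leq_b1.
move=> IHA; rewrite -[RHS]IHA.
by apply: eq_bigl => i; rewrite B_DU andbCA andbC.
Qed.

Lemma sum_disjoint_eq0 {U : zmodType} {V I : finType}
    (F : I -> {set V}) (w : I -> U) (d : nat) (B : {set V}) :
  (forall C : {set V}, (#|C| <= d)%N -> \sum_(i | C \subset F i) w i = 0) ->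
  (#|B| <= d)%N -> \sum_(i | [disjoint B & F i]%B) w i = 0.
Proof.
move=> w0 leBd; rewrite -[RHS](@sum_subset_disjoint_eq0 _ _ _ F w d set0 B w0).
  by apply: eq_bigl => i; rewrite sub0set.
by rewrite cards0.
Qed.

(** If a family of [k]-sets is indexed injectively and [k] exceeds half of the
    number of vertices, then avoiding the complement of [F i0] singles out the
    index [i0]. *)
Lemma uniform_family_weight_eq0 {U : zmodType} {V I : finType}
    (F : I -> {set V}) (w : I -> U) (d : nat) :
  injective F -> (forall i, #|F i| = d.+1) -> (#|V| < d.+1.*2)%N ->
  (forall C : {set V}, (#|C| <= d)%N -> \sum_(i | C \subset F i) w i = 0) ->
  forall i, w i = 0.
Proof.
move=> injF cardF ltV w0 i0.
(* #|V| - d.+1 <= d restates #|V| < d.+1.*2 *)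
have leC : (#|~: F i0| <= d)%N.
  by rewrite cardsCs setCK cardF leq_subLR -ltnS -addnS addnn.
rewrite -[RHS](sum_disjoint_eq0 F w d _ w0 leC) (big_pred1 i0) // => i /=.
rewrite disjoint_sym disjoints_subset setCK -(inj_eq injF) eqEcard.
by rewrite !cardF leqnn andbT.
Qed.

(** A multiset coerces to the sequence of its elements with repetitions, so
    [uniq] expresses that all the multiplicities are at most one; such a
    multiset carries the same information as its support. *)
Section SetLikeMultisets.
Variable V : finType.
Implicit Types (S sigma : {mset V}) (C : {set V}).

Lemma mset_uniqE sigma (i : V) : uniq sigma -> sigma i = (i \in sigma).
Proof. by move=> /count_uniq_mem <-; rewrite count_mem_mset. Qed.

Lemma support_inj sigma1 sigma2 : uniq sigma1 -> uniq sigma2 ->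
  [set i in sigma1] = [set i in sigma2] -> sigma1 = sigma2.
Proof.
move=> u1 u2 /setP eq12; apply/msetP => i.
by rewrite !mset_uniqE //; have := eq12 i; rewrite !inE => ->.
Qed.

(** Translates the balancing equations, indexed by multisets, into equations
    indexed by sets of vertices. *)
Lemma seq_mset_enum_sub C sigma : uniq sigma ->
  (seq_mset (enum C) `<=` sigma)%mset = (C \subset [set i in sigma]).
Proof.
move=> us; apply/msubsetP/subsetP => sub i; last first.
  rewrite mset_seqE count_uniq_mem ?enum_uniq // mem_enum mset_uniqE //.
  by case: (boolP (i \in C)) => // /sub; rewrite inE => ->.
move=> iC; have := sub i.
by rewrite mset_seqE count_uniq_mem ?enum_uniq // mem_enum iC inE in_mset.
Qed.

Lemma msub_mult_uniq S sigma :
  uniq sigma -> (S `<=` sigma)%mset -> msub_mult S sigma = 1%N.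
Proof.
move=> us /msubsetP sub; apply: big1 => i _.
have := sub i; rewrite (mset_uniqE _ i us).
by case: (i \in sigma); case: (S i) => [|[|k]].
Qed.

End SetLikeMultisets.

Lemma nonsingular_uniq {V : finType} {Delta : {fset {mset V}}} (sigma : {mset V}) :
  nonsingular Delta -> sigma \in Delta -> uniq sigma.
Proof.
move=> nsD sD; apply/count_mem_uniq => i; rewrite count_mem_mset.
case: (boolP (i \in sigma)) => [/nsD->//|].
by rewrite in_mset -eqn0Ngt => /eqP.
Qed.

Theorem corollary5p6 (K : fieldType) (charK0 : [pchar K] =i pred0)
    (n d : nat) (hn : (1 <= n)%N) (hd : n%:R / 2%:R < d.+1%:R :> rat) :
  ~ exists (V : finType) (Delta : {fset {mset V}}),
      [/\ is_complex n d Delta, nonsingular Delta, Delta != fset0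
        & balanceable K d Delta].
Proof.
case=> V [Delta [[cardV sizeD] nsD /fset0Pn[sigma0 s0D] [w [w_neq0 w0]]]].
have uD (sigma : Delta) : uniq (val sigma : {mset V}) by apply: nonsingular_uniq (valP sigma).
suff: w [` s0D] = 0 by apply/eqP.
apply: (@uniform_family_weight_eq0 _ _ _
  (fun sigma : Delta => [set i in (val sigma : {mset V})]) w d).
- by move=> s1 s2 /support_inj eq12; apply/val_inj/eq12.
- by move=> sigma; rewrite cardsE (card_uniqP (uD sigma)) sizeD ?(valP sigma).
- by move: hd; rewrite Num.Theory.ltr_pdivrMr // -natrM Num.Theory.ltr_nat cardV muln2.
move=> C leC; rewrite -[RHS](w0 (seq_mset (enum C))); last first.
  by rewrite (perm_size (perm_eq_seq_mset _)) -cardE.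
apply: eq_big => sigma; first by rewrite seq_mset_enum_sub.
by rewrite -seq_mset_enum_sub // => sub; rewrite msub_mult_uniq // mulr1.
Qed.
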